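(* Let $$S=\{5,10,15,20,25,30,35,40,45,50,70,75,3,37,4,21,6,74,8,42,12,63,13,47,29,46,33,67,34,51,39,56,43,77,44,61,48,82,49,66,64,81\},$$ $$T=\{5,10,15,20,25,30,35,40,50,55,70,75,2,53,9,26,12,63,13,47,14,31,18,52,24,41,28,62,32,83,34,51,38,72,43,77,44,61,59,76,64,81\},$$ viewed as subsets of $\mathbb{Z}_{85}=\{0,1,\ldots,84\}$. Define $\mathbf a,\mathbf b\in\{-1,1\}^{85}$ by $a_i=-1$ if $i\in S$ and $a_i=1$ otherwise, and $b_i=-1$ if $i\in T$ and $b_i=1$ otherwise. Then $(\mathbf a,\mathbf b)$ is a Legendre pair of length $85$, and $\{1,69\}\subseteq \widehat G_{\mathbf a}$ and $\{1,69\}\subseteq\widehat G_{\mathbf b}$. In particular, a Legendre pair of length $85$ exists.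
   Context: For $\mathbf a\in\mathbb{R}^\ell$ indexed by $\mathbb{Z}_\ell$, the periodic autocorrelation function is $\mathrm{PAF}_{\mathbf a}(j)=\sum_{i=0}^{\ell-1}a_i a_{i-j}$ (indices mod $\ell$). A pair $(\mathbf a,\mathbf b)$ of vectors in $\{-1,1\}^\ell$ is a Legendre pair of length $\ell$ if $\mathrm{PAF}_{\mathbf a}(j)+\mathrm{PAF}_{\mathbf b}(j)=-2$ for all $j\in\mathbb{Z}_\ell\setminus\{0\}$ and $\sum_i a_i=\sum_i b_i$. For $k\in\mathbb{Z}_\ell^\times$ the decimation $d_k$ acts on vectors by $(d_k(\mathbf a))_i=a_{k^{-1}i}$, and $\widehat G_{\mathbf a}=\{k\in\mathbb{Z}_\ell^\times\mid d_k(\mathbf a)=\mathbf a\}$. *)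

(* Defs.v *)
From HB Require Import structures.
From mathcomp Require Import all_boot all_order all_algebra.
From mathcomp Require Import reals.

Set Implicit Arguments.
Unset Strict Implicit.
Unset Printing Implicit Defensive.

Import Order.TTheory GRing.Theory Num.Theory.

Local Open Scope ring_scope.

(* A vector of length l with entries in R is a finite function on 'Z_l.
   Since 'Z_0 and 'Z_1 are both Z/2, these definitions have their usual
   meaning only for 1 < l. *)

Definition PAF (R : realType) (l : nat) (a : {ffun 'Z_l -> R}) (j : 'Z_l) : R :=
  \sum_(i : 'Z_l) a i * a (i - j).

Definition pm1_vector (R : realType) (l : nat) (a : {ffun 'Z_l -> R}) : Prop :=
  forall i : 'Z_l, a i = -1 \/ a i = 1.

Definition Legendre_pair (R : realType) (l : nat) (a b : {ffun 'Z_l -> R}) :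
    Prop :=
  [/\ pm1_vector a, pm1_vector b,
      forall j : 'Z_l, j != 0 -> PAF a j + PAF b j = - 2%:R
    & \sum_(i : 'Z_l) a i = \sum_(i : 'Z_l) b i].

(* Only meaningful when k is a unit: otherwise k^-1 is k by convention. *)
Definition decimation (R : realType) (l : nat) (k : 'Z_l)
    (a : {ffun 'Z_l -> R}) : {ffun 'Z_l -> R} :=
  [ffun i => a (k^-1 * i)].

Definition Ghat (R : realType) (l : nat) (a : {ffun 'Z_l -> R}) : {set 'Z_l} :=
  [set k : 'Z_l | (k \is a GRing.unit) && (decimation k a == a)].

Definition S85 : {set 'Z_85} :=
  [set i : 'Z_85 | (i : nat) \in
    [:: 5; 10; 15; 20; 25; 30; 35; 40; 45; 50; 70; 75; 3; 37; 4; 21; 6; 74; 8;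
        42; 12; 63; 13; 47; 29; 46; 33; 67; 34; 51; 39; 56; 43; 77; 44; 61; 48;
        82; 49; 66; 64; 81]%N].

Definition T85 : {set 'Z_85} :=
  [set i : 'Z_85 | (i : nat) \in
    [:: 5; 10; 15; 20; 25; 30; 35; 40; 50; 55; 70; 75; 2; 53; 9; 26; 12; 63;
        13; 47; 14; 31; 18; 52; 24; 41; 28; 62; 32; 83; 34; 51; 38; 72; 43; 77;
        44; 61; 59; 76; 64; 81]%N].

Definition minus_one_on (R : realType) (l : nat) (A : {set 'Z_l}) :
    {ffun 'Z_l -> R} :=
  [ffun i => if i \in A then -1 else 1].

(* Main.v *)
(* Writing a vector of signs as (-1)^c with c a boolean word, PAF(j) is the
   length minus twice the Hamming distance between c and its cyclic shift
   by j. So the pair is Legendre iff, for every nonzero shift, the two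
   distances add up to 86 and the two words have the same weight, which is a
   finite computation on words of length 85. *)
Require Import Defs.
From HB Require Import structures.
From mathcomp Require Import all_boot all_order all_algebra.
From mathcomp Require Import reals.

Set Implicit Arguments.
Unset Strict Implicit.
Unset Printing Implicit Defensive.

Import Order.TTheory GRing.Theory Num.Theory.

Local Open Scope ring_scope.

Lemma minus_one_onE (R : realType) (l : nat) (A : {set 'Z_l}) i :
  minus_one_on R A i = (-1) ^+ (i \in A).
Proof. by rewrite ffunE; case: (i \in A). Qed.

Lemma minus_one_on_pm1 (R : realType) (l : nat) (A : {set 'Z_l}) :
  pm1_vector (minus_one_on R A).
Proof. by move=> i; rewrite ffunE; case: ifP; [left | right]. Qed.

Lemma sum_signs (R : pzRingType) (n : nat) (c : pred nat) :
  \sum_(i < n) (-1) ^+ (c i) = n%:R - (2 * count c (iota 0 n))%:R :> R.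
Proof.
have signE (x : bool) : (-1) ^+ x = 1 - (2 * x)%:R :> R.
  by case: x; rewrite ?subr0 // opprD addrA subrr add0r.
under eq_bigr do rewrite signE.
rewrite sumrB sumr_const card_ord -natr_sum -big_distrr /=.
congr (_ - (_ * _)%:R).
rewrite -sum1_count -[n in iota 0 n]subn0 -/(index_iota 0 n) big_mkord.
by rewrite [RHS]big_mkcond; apply: eq_bigr => i _; case: (c i).
Qed.

(** A plain list of booleans, so that [vm_compute] can evaluate every check made on it, unlike the
    finite functions and sets over ['Z_l]. *)
Definition char_word (l : nat) (s : seq nat) : bitseq :=
  mkseq (fun i => i \in s) l.

Lemma nth_char_word l s i : (i < l)%N -> nth false (char_word l s) i = (i \in s).
Proof. exact: nth_mkseq. Qed.

(** Adding [l - j] represents [i - j] modulo [l] without the truncation of subtraction on [nat]. *)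
Definition shift_dist (l : nat) (w : bitseq) (j : nat) : nat :=
  count (fun i => nth false w i (+) nth false w ((i + (l - j)) %% l)) (iota 0 l).

Section NatSeqSupport.

Variables (R : realType) (n : nat) (s : seq nat).
(** With this form of the length, ['Z_l] is convertible to ['I_l]. *)
Let l := n.+2.
Let A : {set 'Z_l} := [set i : 'Z_l | (i : nat) \in s].

Lemma sum_minus_one_on :
  \sum_i minus_one_on R A i =
  l%:R - (2 * count id (char_word l s))%:R.
Proof.
under eq_bigr do rewrite minus_one_onE inE.
by rewrite (sum_signs _ _ (fun i => i \in s)) count_map.
Qed.

(** A product of two signs is -1 to the exclusive or of their bits, so [sum_signs] counts the
    positions where the word and its shift disagree. *)
Lemma PAF_minus_one_on (j : 'Z_l) :
  PAF (minus_one_on R A) j =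
  l%:R - (2 * shift_dist l (char_word l s) j)%:R.
Proof.
rewrite /PAF -sum_signs; apply: eq_bigr => i _.
rewrite !minus_one_onE !inE -signr_addb nth_char_word ?ltn_ord //.
(* The opposite of [j] in ['Z_l] is [(l - j) %% l]; [modnDmr] removes this inner reduction. *)
by rewrite nth_char_word ?ltn_pmod //= modnDmr.
Qed.

(** Since [k] is its own inverse modulo [l], invariance under decimation by [k] can be tested at
    [k * i], with no inverse to compute. *)
Lemma natr_mem_Ghat (k : nat) :
  k * k = 1 %[mod l] ->
  all (fun i => nth false (char_word l s) ((k * i) %% l) ==
                nth false (char_word l s) i) (iota 0 l) ->
  k%:R \in Ghat (minus_one_on R A).
Proof.
move=> kk1 /allP sk.
have kk : k%:R * k%:R = 1 :> 'Z_l.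
  by rewrite -natrM -Zp_nat_mod // kk1 Zp_nat_mod.
have uk : (k%:R : 'Z_l) \is a GRing.unit by apply/unitrPr; exists k%:R.
have kV : k%:R^-1 = k%:R :> 'Z_l by apply: (mulrI uk); rewrite mulrV // kk.
rewrite inE uk; apply/eqP/ffunP => i.
rewrite ffunE !minus_one_onE !inE kV; congr (_ ^+ nat_of_bool _).
have /sk/eqP : (i : nat) \in iota 0 l by rewrite mem_iota ltn_ord.
rewrite !nth_char_word ?ltn_pmod // => <-.
have -> : k%:R * i = (k * i)%:R :> 'Z_l by rewrite natrM natr_Zp.
by rewrite val_Zp_nat.
Qed.

End NatSeqSupport.

Lemma Legendre_pair_minus_one_on (R : realType) (n : nat) (s t : seq nat) :
  let l := n.+2 in
  let u := char_word l s in let v := char_word l t in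
  count id u = count id v ->
  all (fun j => shift_dist l u j + shift_dist l v j == l.+1)%N (iota 1 l.-1) ->
  Legendre_pair (minus_one_on R [set i : 'Z_l | (i : nat) \in s])
                (minus_one_on R [set i : 'Z_l | (i : nat) \in t]).
Proof.
move=> l u v uv /allP dist; split; try exact: minus_one_on_pm1.
  move=> j j0; rewrite !PAF_minus_one_on addrACA -opprD -!natrD -mulnDr.
  have /dist/eqP -> : (j : nat) \in iota 1 l.-1.
    by rewrite mem_iota lt0n j0 add1n ltn_ord.
  (* The two distances add up to [l + 1], which leaves 2l - 2(l + 1) = -2. *)
  by rewrite mulnS mul2n addnn natrD opprD addrCA subrr addr0.
by rewrite !sum_minus_one_on uv.
Qed.

Theorem mainTheorem1 (R : realType) :
  let a := minus_one_on R S85 in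
  let b := minus_one_on R T85 in
  [/\ Legendre_pair a b,
      [set 1; 69%:R] \subset Ghat a,
      [set 1; 69%:R] \subset Ghat b
    & exists a' b' : {ffun 'Z_85 -> R}, Legendre_pair a' b'].
Proof.
move=> a b.
have ab : Legendre_pair a b.
  by apply: (@Legendre_pair_minus_one_on R 83); vm_compute.
split; [exact: ab | | | by exists a, b].
- apply/subsetP => k /set2P[] ->.
    by apply: (@natr_mem_Ghat R 83 _ 1); vm_compute.
  (* The length 85 is [83.+2], and 69 * 69 = 4761 = 56 * 85 + 1. *)
  by apply: (@natr_mem_Ghat R 83 _ 69); vm_compute.
- apply/subsetP => k /set2P[] ->.
    by apply: (@natr_mem_Ghat R 83 _ 1); vm_compute.
  by apply: (@natr_mem_Ghat R 83 _ 69); vm_compute.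
Qed.
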